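(* Consider the field extension $\mathbb{F}_q \subsetneq \mathbb{F}_{q^{m}}$, where $q$ is a prime power and $m$ is a composite number. Let $t$ be the smallest prime divisor of $m$, and let $n$ be an integer with $t \le n < m$. Then there exist $\mathbb{F}_q$-subspaces $A,B \subseteq \mathbb{F}_{q^{m}}$ with $\dim A=\dim B=n$ and $1\notin B$ such that the pair $(A,B)$ is unmatchable (with respect to the extension $\mathbb{F}_q \subsetneq \mathbb{F}_{q^{m}}$) if and only if there exists a positive divisor $d$ of $m$ such that $d \leq n$ and $d\nmid (n+1)$.
   Context: Let $K\subsetneq L$ be a field extension and let $A,B$ be $n$-dimensional $K$-subspaces of $L$ with $n>0$. For a subset $X$ of $L$, $\langle X\rangle$ denotes the $K$-subspace of $L$ spanned by $X$. An ordered basis $\{a_1,\ldots,a_n\}$ of $A$ is matched to an ordered basis $\{b_1,\ldots,b_n\}$ of $B$ if, for each $i\in\{1,\ldots,n\}$, $a_i^{-1}A\cap B\subseteq \langle b_1,\ldots,b_{i-1},b_{i+1},\ldots,b_n\rangle$. The subspace $A$ is matched to $B$ (equivalently, the pair $(A,B)$ is matchable) if every ordered basis of $A$ can be matched to some ordered basis of $B$; otherwise $(A,B)$ is unmatchable. Here $K=\mathbb{F}_q$, $L=\mathbb{F}_{q^m}$, and dimensions are over $\mathbb{F}_q$. *)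

(* Defs.v *)
From HB Require Import structures.
From mathcomp Require Import all_boot all_order all_algebra all_field.

Set Implicit Arguments.
Unset Strict Implicit.
Unset Printing Implicit Defensive.

Import GRing.Theory.
Local Open Scope ring_scope.

Definition basis_matched (K : fieldType) (L : fieldExtType K)
    (A B : {vspace L}) (n : nat) (a b : n.-tuple L) : Prop :=
  forall i : 'I_n,
    ((<[(tnth a i)^-1]> * A) :&: B <= <<[seq tnth b j | j in predC1 i]>>)%VS.

(* Both bases are indexed by 'I_(\dim A): this avoids casts, and is meant to be
   used when \dim A = \dim B (no basis of B has this length otherwise). *)
Definition matchable (K : fieldType) (L : fieldExtType K)
    (A B : {vspace L}) : Prop :=
  forall a : (\dim A).-tuple L, basis_of A a ->
    exists2 b : (\dim A).-tuple L, basis_of B b & basis_matched A B a b.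

Definition unmatchable (K : fieldType) (L : fieldExtType K)
    (A B : {vspace L}) : Prop := ~ matchable A B.

(* Main.v *)
(* [(A, B)] is unmatchable iff there are [V <= A], [W <= B] with [V * W <= A] and
   [\dim V + \dim W > \dim A] (a dual form of Rado's transversal theorem).  Given
   such [V], [W] with [1 \notin W], the e-transform applied to [V] and [W + <[1]>]
   gives a module [M] over a subfield [F], of dimension at most [n], with
   [\dim M + \dim F >= n + 2].  Since [\dim F] divides [\dim M], it cannot
   divide [n + 1].  Conversely, if [F] is the subfield of degree [d], take for
   [V] an [F]-submodule of [A] of the largest dimension at most [n], and for [W]
   a hyperplane of [F] avoiding [1]. *)
Require Import Defs.
From HB Require Import structures.
From mathcomp Require Import all_boot all_order all_algebra all_field.
From mathcomp Require Import all_fingroup all_solvable zify.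

Set Implicit Arguments.
Unset Strict Implicit.
Unset Printing Implicit Defensive.

Import GRing.Theory.
Local Open Scope ring_scope.

(** * Subspaces avoiding a given vector *)

Lemma dimv_addv_line (F : fieldType) (vT : vectType F) (U : {vspace vT}) v :
  v \notin U -> \dim (U + <[v]>) = (\dim U).+1.
Proof.
move=> Uv; have nz_v: v != 0 by apply: contraNneq Uv => ->; apply: mem0v.
rewrite dimv_disjoint_sum ?dim_vline ?nz_v ?addn1 //.
apply/eqP; rewrite -subv0; apply/subvP => x /memv_capP[Ux /vlineP[c Dx]].
rewrite memv0 Dx scaler_eq0 (negPf nz_v) orbF; apply: contraR Uv => nz_c.
by rewrite -[v]scale1r -(mulVf nz_c) -scalerA -Dx memvZ.
Qed.

Lemma dimv_lt_notin (F : fieldType) (vT : vectType F) (U S : {vspace vT}) :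
  (\dim U < \dim S)%N -> exists2 v, v \in S & v \notin U.
Proof.
move=> ltUS; have /subvPn[v Sv Uv]: ~~ (S <= U)%VS.
  by apply: contraL ltUS => /dimvS; rewrite -leqNgt.
by exists v.
Qed.

(** Vectors are added one at a time, each taken outside [X + <[v]>] rather than merely outside [X];
    there is room while [\dim X + 1 < \dim S]. *)
Lemma vspace_extend_avoiding (F : fieldType) (vT : vectType F)
    (U S : {vspace vT}) (v : vT) (k : nat) :
    (U <= S)%VS -> v \in S -> v \notin U -> (\dim U <= k < \dim S)%N ->
  exists X : {vspace vT}, [/\ (U <= X)%VS, (X <= S)%VS, v \notin X & \dim X = k].
Proof.
move=> sUS Sv Uv /andP[leUk ltkS].
elim: k leUk ltkS => [|k IHk] leUk ltkS.
  by exists U; split=> //; apply/eqP; rewrite -leqn0.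
have [/eqP dU|] := boolP (\dim U == k.+1); first by exists U.
rewrite neq_ltn [(k.+1 < _)%N]ltnNge leUk orbF ltnS => leUk'.
have [X [sUX sXS Xv dX]] := IHk leUk' (ltnW ltkS).
have [w Sw Xvw] : exists2 w, w \in S & w \notin (X + <[v]>)%VS.
  by apply: dimv_lt_notin; rewrite dimv_addv_line // dX.
have Xw: w \notin X by apply: contra Xvw; apply: subvP (addvSl _ _) _.
exists (X + <[w]>)%VS; split.
- exact: subv_trans sUX (addvSl _ _).
- by rewrite subv_add sXS -memvE.
- apply: contra Xvw => /memv_addP[x Xx [_ /vlineP[c ->] Dv]].
  have nz_c : c != 0.
    by apply: contraNneq Xv => c0; rewrite Dv c0 scale0r addr0.
  have ->: w = - c^-1 *: x + c^-1 *: v.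
    by rewrite Dv scalerDr scalerA mulVf // scale1r addrA scaleNr addNr add0r.
  by apply: memv_add; rewrite memvZ // memv_line.
- by rewrite dimv_addv_line // dX.
Qed.

(** * The e-transform and modules over subfields *)

Lemma memv_prod_lineV (K : fieldType) (L : fieldExtType K) (A : {vspace L}) a x :
  a != 0 -> (x \in <[a^-1]> * A)%VS = (a * x \in A).
Proof.
move=> nz_a; rewrite prodvC; apply/memv_cosetP/idP => [[y Ay ->]|Aax].
  by rewrite mulrCA divff // mulr1.
by exists (a * x); rewrite // mulrAC divff ?mul1r.
Qed.

(* The Dyson e-transform [(A, B) -> (A :&: B e^-1, B + A e)] keeps the sum of
   the dimensions and shrinks both [A] and the product; it is blocked only when
   [A * B = B], and then [B] is a module over the field generated by [A]. *)
Lemma module_in_prodv (K : fieldType) (L : fieldExtType K) (A B : {vspace L}) :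
    1 \in A -> B != 0%VS ->
  exists (F : {subfield L}) (M : {vspace L}),
    [/\ (F * M <= M)%VS, (B <= M)%VS, (M <= A * B)%VS
      & (\dim A + \dim B <= \dim M + \dim F)%N].
Proof.
have [k] := ubnP (\dim A); elim: k A B => // k IHk A B ltAk A1 nzB.
have sBAB: (B <= A * B)%VS by rewrite -{1}[B]prod1v prodvSl // -memvE.
have [sABB|] := boolP (A * B <= B)%VS.
  exists <<A>>%AS, B; split=> //; first exact: agenv_modl.
  by rewrite addnC leq_add2l dimvS // sub_agenv.
move=> nsABB; have /hasP[e Be nsAeB]: has (fun e => ~~ (A * <[e]> <= B)%VS) (vbasis B).
  apply: contraR nsABB => /hasPn nAe; apply/prodvP => a b Aa /coord_vbasis->.
  rewrite mulr_sumr memv_suml // => i _; rewrite -scalerAr memvZ //.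
  have /nAe := memt_nth 0 (vbasis B) (ltn_ord i); rewrite negbK => /subvP; apply.
  by rewrite memv_mul // memv_line.
have {}Be := vbasis_mem Be.
have nz_e : e != 0 by apply: contraNneq nsAeB => ->; rewrite prodv0 sub0v.
pose A' := (A :&: B * <[e^-1]>)%VS; pose B' := (B + A * <[e]>)%VS.
have A'e : (A' * <[e]> = A * <[e]> :&: B)%VS.
  apply/vspaceP => x; rewrite memv_cap.
  have Dx : x = (x / e) * e by rewrite divfK.
  have inE_coset U : (x \in U * <[e]>)%VS = (x / e \in U).
    by rewrite prodvC -{1}[e]invrK memv_prod_lineV ?invr_eq0 // mulrC.
  rewrite !inE_coset memv_cap; congr (_ && _).
  by rewrite prodvC memv_prod_lineV // mulrC divfK.
have dA' : \dim A' = \dim (A * <[e]> :&: B) by rewrite -A'e dim_cosetv.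
have dAe : \dim (A * <[e]>) = \dim A by rewrite dim_cosetv.
have dsum : (\dim A' + \dim B' = \dim A + \dim B)%N.
  by rewrite dA' addnC /B' addvC dimv_sum_cap dAe.
have ltA'A : (\dim A' < \dim A)%N.
  rewrite dA' -dAe (ltn_leqif (dimv_leqif_sup (capvSl _ _))).
  by rewrite subv_cap subvv.
have A'1 : 1 \in A' by rewrite memv_cap A1 prodvC memv_prod_lineV ?mulr1.
have nzB' : B' != 0%VS.
  by apply: contraNneq nzB => B'0; rewrite -subv0 -B'0 addvSl.
have [F [M [modM sB'M sMA'B' leM]]] := IHk A' B' (leq_trans ltA'A ltAk) A'1 nzB'.
exists F, M; split=> //; last by rewrite -dsum.
  exact: subv_trans (addvSl _ _) sB'M.
(* [A' * B'] is the sum of [A' * B] and [A * (A' * <[e]>)]; the latter lies in [A * B] because [A' *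
   <[e]> <= B]. *)
apply: subv_trans sMA'B' _; rewrite prodvDr subv_add prodvSl ?capvSl //=.
rewrite prodvA -[(A' * A)%VS]prodvC -prodvA prodvSr //.
by rewrite A'e capvSr.
Qed.

Lemma subfield_not_dvdn (K : fieldType) (L : fieldExtType K)
    (A V W : {vspace L}) :
    V != 0%VS -> 1 \notin W -> (V <= A)%VS -> (V * W <= A)%VS ->
    (\dim A < \dim V + \dim W)%N ->
  exists F : {subfield L}, (\dim F <= \dim A)%N && ~~ (\dim F %| (\dim A).+1)%N.
Proof.
move=> nzV W1 sVA sVWA ltA.
(* Dividing by [a] puts 1 into [V1]; the product [V1 * W1'] is a translate of [V * W + V], hence of
   dimension at most [\dim A]. *)
pose a := vpick V; have nz_a : a != 0 by rewrite vpick0.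
pose V1 := (<[a^-1]> * V)%VS; pose W1' := (W + <[1]>)%VS.
have V1_1 : 1 \in V1 by rewrite memv_prod_lineV // mulr1 memv_pick.
have nzW1 : W1' != 0%VS.
  by rewrite -dimv_eq0 dimv_addv_line.
have [F [M [modM sWM sMVW leM]]] := module_in_prodv V1_1 nzW1.
have dV1 : \dim V1 = \dim V by rewrite /V1 prodvC dim_cosetv ?invr_eq0.
have leMA : (\dim M <= \dim A)%N.
  apply: leq_trans (dimvS sMVW) _; rewrite /V1 -prodvA prodvC dim_cosetv ?invr_eq0 //.
  by apply: dimvS; rewrite prodvDr subv_add sVWA prodv1.
have dvdFM : (\dim F %| \dim M)%N := field_module_dimS modM.
have Mgt0 : (0 < \dim M)%N.
  by rewrite (leq_trans _ (dimvS sWM)) // lt0n dimv_eq0.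
have leFM := dvdn_leq Mgt0 dvdFM.
exists F; rewrite (leq_trans leFM leMA) /=.
(* Otherwise [\dim F] divides the positive number [\dim A + 1 - \dim M], against
   [\dim M + \dim F >= \dim A + 2]. *)
apply/negP => dvdFA; move: leM; rewrite dV1 dimv_addv_line // addnS leqNgt.
case/negP; rewrite ltnS; apply: leq_trans ltA.
rewrite -leq_subRL ?(leq_trans leMA) // dvdn_leq ?subn_gt0 //.
exact: dvdn_sub.
Qed.

(** * Subfields and submodules of prescribed dimension *)

(** The Galois group is cyclic of order [\dim {:L}]; if [alpha] generates it, the fixed field of
    [alpha ^+ d] has degree [d]. *)
Lemma exists_subfield_dim (K : finFieldType) (L : fieldExtType K) d :
  (d %| \dim {:L})%N -> exists F : {subfield L}, \dim F = d.
Proof.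
wlog [{}L ->]: L / exists galL : splittingFieldType K, L = galL.
  by pose galL := FinSplittingFieldType K L => /(_ galL); apply; exists galL.
move=> dvd_d.
have gal1 := finField_galois (sub1v {:L}%AS).
have [alpha /eqP genG _] := finField_galois_generator (sub1v {:L}%AS).
have oG : #|'Gal({:L} / 1)%g| = \dim {:L}.
  by rewrite -galois_dim // dimv1 divn1.
have o_alpha : #[alpha]%g = \dim {:L} by rewrite -oG genG.
exists (fixedField <[(alpha ^+ d)%g]>%g)%AS.
have L_gt0 : (0 < \dim {:L})%N := adim_gt0 {:L}%AS.
have := dim_fixedField <[(alpha ^+ d)%g]>%G.
rewrite -orderE orderXdiv o_alpha // => dF.
have := field_dimS (subvf (fixedField <[(alpha ^+ d)%g]>%g)%AS).
move=> /divnK; rewrite -dF => eF.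
have: (\dim {:L} %/ d * d = \dim {:L})%N by rewrite divnK.
rewrite -{2}eF => /eqP; rewrite eqn_pmul2l; first by move/eqP.
by rewrite divn_gt0 ?(dvdn_leq L_gt0) // (dvdn_gt0 L_gt0).
Qed.

(** [F]-lines are added one by one: for [x] outside the [F]-module [M], [F * <[x]>] meets [M] only
    in 0. *)
Lemma exists_submodule_dim (K : fieldType) (L : fieldExtType K)
    (F : {subfield L}) k :
    (\dim F * k <= \dim {:L})%N ->
  exists2 M : {vspace L}, (F * M <= M)%VS & \dim M = (\dim F * k)%N.
Proof.
elim: k => [|k IHk] le_k; first by exists 0%VS; rewrite ?prodv0 // dimv0 muln0.
have F_gt0 := adim_gt0 F.
have [M modM dM] : exists2 M : {vspace L}, (F * M <= M)%VS & \dim M = (\dim F * k)%N.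
  by apply: IHk; apply: leq_trans le_k; rewrite leq_mul2l leqnSn orbT.
have [x _ Mx] : exists2 x, x \in {:L}%VS & x \notin M.
  by apply: dimv_lt_notin; rewrite dM; lia.
have nz_x : x != 0 by apply: contraNneq Mx => ->; apply: mem0v.
exists (M + F * <[x]>)%VS.
  by rewrite prodvDr addvS // prodvA prodv_id.
rewrite dimv_disjoint_sum ?dM ?dim_cosetv // ?mulnS 1?addnC //.
apply/eqP; rewrite -subv0; apply/subvP => y /memv_capP[My /memv_cosetP[f Ff Dy]].
rewrite memv0 Dy mulf_eq0 (negPf nz_x) orbF; apply: contraR Mx => nz_f.
by rewrite -(mulKf nz_f x) -Dy (subvP modM) // memv_mul // memvV.
Qed.

(** * Rado's transversal theorem in dual form *)

(** Each [U i] has codimension at most one in [B], so each intersection costs at most one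
    dimension. *)
Lemma dim_bigcap_hyperplanes (F : fieldType) (vT : vectType F)
    (B : {vspace vT}) (n : nat) (U : 'I_n -> {vspace vT}) (J : {set 'I_n}) :
    (forall i, (U i <= B)%VS) -> (forall i, (\dim B <= (\dim (U i)).+1)%N) ->
  (\dim B <= \dim (B :&: \bigcap_(i in J) U i) + #|J|)%N.
Proof.
move=> sUB leU; rewrite -big_enum /= cardE.
elim: (enum J) => [|i r IHr]; first by rewrite big_nil capvf addn0.
rewrite big_cons capvA (capvC B) -capvA /=.
have := dimv_sum_cap (U i) (B :&: \bigcap_(j <- r) U j).
have: (\dim (U i + B :&: \bigcap_(j <- r) U j) <= \dim B)%N.
  by rewrite dimvS // subv_add sUB capvSl.
move: (leU i) IHr; move: (\bigcap_(j <- r) U j)%VS => R.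
move: (size r) (\dim (U i)) (\dim B) (\dim (B :&: R)) (\dim (U i + _)) (\dim (U i :&: _)).
lia.
Qed.

(** This is a dual basis: [b_i] is a nonzero vector common to all [U j] with [j != i], and it lies
    outside [U i] since the total intersection is 0. *)
Lemma basis_of_hyperplanes (F : fieldType) (vT : vectType F)
    (B : {vspace vT}) (n : nat) (U : 'I_n -> {vspace vT}) :
    \dim B = n -> (forall i, (U i <= B)%VS) ->
    (forall i, (n <= (\dim (U i)).+1)%N) ->
    (B :&: \bigcap_i U i = 0)%VS ->
  exists2 b : n.-tuple vT, basis_of B b
    & forall i, (U i <= <<[seq tnth b j | j in predC1 i]>>)%VS.
Proof.
move=> dB sUB leU capU0.
pose W i := (B :&: \bigcap_(j in [set~ i]) U j)%VS.
pose b := [tuple vpick (W i) | i < n].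
have Wb i : tnth b i \in W i by rewrite tnth_mktuple memv_pick.
have Bb i : tnth b i \in B by case/memv_capP: (Wb i).
have Ub i j : j != i -> tnth b i \in U j.
  move=> ne_ji; case/memv_capP: (Wb i) => _; apply: subvP.
  by apply: (@bigcapv_inf _ _ _ j); rewrite // !inE.
have UNb i : tnth b i \notin U i.
  have: tnth b i != 0.
    rewrite tnth_mktuple vpick0 -dimv_eq0.
    have := @dim_bigcap_hyperplanes _ _ B _ U [set~ i] sUB.
    rewrite dB => /(_ leU); rewrite cardsC1 card_ord -/(W i).
    apply: contraL => /eqP->; rewrite add0n -ltnNge prednK //.
    exact: leq_trans (ltn_ord i).
  apply: contra => Uib; rewrite -memv0 -capU0 memv_cap Bb /=.
  rewrite memvE; apply/subv_bigcapP => j _; rewrite -memvE.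
  by have [->|/Ub] := eqVneq j i.
have freeb : free b.
  apply/freeP => k; under eq_bigr do rewrite -tnth_nth.
  move=> sum0 i; apply: contraNeq (UNb i) => nz_k.
  rewrite -[tnth b i]scale1r -(mulVf nz_k) -scalerA memvZ //.
  move/eqP: sum0; rewrite (bigD1 i) //= addr_eq0 => /eqP->.
  by rewrite memvN memv_suml // => j ne_ji; rewrite memvZ // Ub // eq_sym.
have basb : basis_of B b.
  rewrite basisEfree freeb size_tuple dB leqnn andbT.
  by apply/span_subvP => _ /tnthP[i ->]; rewrite Bb.
exists b => // i; set S := <<_>>%VS.
have sSU : (S <= U i)%VS.
  by apply/span_subvP => _ /imageP[j ne_ji ->]; rewrite Ub // eq_sym.
have sBS : (B <= <[tnth b i]> + S)%VS.
  rewrite -(span_basis basb); apply/span_subvP => _ /tnthP[j ->].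
  have [->|ne_ji] := eqVneq j i; first by rewrite (subvP (addvSl _ _)) ?memv_line.
  by rewrite (subvP (addvSr _ _)) // memv_span // image_f.
have Sb : tnth b i \notin S by apply: contra (UNb i); apply: subvP.
(* [S] has codimension at most one in [B] and lies in the proper subspace [U i], so the two
   coincide. *)
rewrite -(geq_leqif (dimv_leqif_sup sSU)) -ltnS -(dimv_addv_line Sb) addvC.
apply: leq_trans (dimvS sBS); rewrite dB.
have: (U i != B) by apply: contraNneq (UNb i) => ->.
by rewrite -dB; have /ltn_leqif <- := dimv_leqif_eq (sUB i).
Qed.

(** Rado's condition for [\dim B = n]: with [U i] the annihilator of a space of functionals on [B],
    the spaces indexed by [J] together span dimension at least [#|J|]. *)
Definition hall_cap (F : fieldType) (vT : vectType F) (B : {vspace vT}) (n : nat)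
    (U : 'I_n -> {vspace vT}) :=
  [forall J : {set 'I_n}, (\dim (B :&: \bigcap_(i in J) U i) + #|J| <= n)%N].

Definition update_at (T : Type) (n : nat) (i0 : 'I_n) (x : T) (U : 'I_n -> T) i :=
  if i == i0 then x else U i.

(** Submodularity: sets [J1], [J2] violating the two conditions both contain [i0], and they
    contradict the condition for [U] at [J1 :|: J2] and [(J1 :&: J2) :\ i0]. *)
Lemma hall_cap_enlarge (F : fieldType) (vT : vectType F) (B X Y : {vspace vT})
    (n : nat) (U : 'I_n -> {vspace vT}) (i0 : 'I_n) :
    hall_cap B U -> (X :&: Y <= U i0)%VS ->
  hall_cap B (update_at i0 X U) || hall_cap B (update_at i0 Y U).
Proof.
move=> /forallP hallU sXYU; apply/norP => -[/forallPn[J1 ltJ1] /forallPn[J2 ltJ2]].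
have memJ Z (J : {set 'I_n}) :
    ~~ (\dim (B :&: \bigcap_(i in J) update_at i0 Z U i) + #|J| <= n)%N -> i0 \in J.
  apply: contraR => J'i0; rewrite (eq_bigr U) ?hallU // => i Ji.
  by rewrite /update_at; case: eqP Ji J'i0 => // -> ->.
have J1i0 := memJ X J1 ltJ1; have J2i0 := memJ Y J2 ltJ2.
set P1 := (B :&: _)%VS in ltJ1; set P2 := (B :&: _)%VS in ltJ2.
have updP Z i : i != i0 -> update_at i0 Z U i = U i.
  by rewrite /update_at => /negPf->.
have sP1 i : i \in J1 -> (P1 <= update_at i0 X U i)%VS.
  by move=> Ji; apply: subv_trans (capvSr _ _) (@bigcapv_inf _ _ _ i _ _ _ _ _).
have sP2 i : i \in J2 -> (P2 <= update_at i0 Y U i)%VS.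
  by move=> Ji; apply: subv_trans (capvSr _ _) (@bigcapv_inf _ _ _ i _ _ _ _ _).
have sPI : (P1 :&: P2 <= B :&: \bigcap_(i in J1 :|: J2) U i)%VS.
  rewrite subv_cap (subv_trans (capvSl _ _)) ?capvSl //=.
  apply/subv_bigcapP => i; rewrite inE => J12i.
  have [->|ne_i] := eqVneq i i0.
    apply: subv_trans sXYU; apply: capvS.
      by have := sP1 _ J1i0; rewrite /update_at eqxx.
    by have := sP2 _ J2i0; rewrite /update_at eqxx.
  case/orP: J12i => [/sP1|/sP2]; rewrite updP //; apply: subv_trans.
    exact: capvSl.
  exact: capvSr.
have sPD : (P1 + P2 <= B :&: \bigcap_(i in (J1 :&: J2) :\ i0) U i)%VS.
  rewrite subv_cap subv_add !capvSl /=; apply/subv_bigcapP => i.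
  rewrite !inE => /and3P[ne_i J1i J2i]; rewrite subv_add.
  by have := sP1 _ J1i; have := sP2 _ J2i; rewrite !updP // => -> ->.
(* The two violations add up to at least [2n + 2], while the condition for [U] allows [2n], plus one
   for the removal of [i0]. *)
have := dimv_sum_cap P1 P2; have := dimvS sPI; have := dimvS sPD.
have := hallU (J1 :|: J2); have := hallU ((J1 :&: J2) :\ i0).
have := cardsUI J1 J2; have := cardsD1 i0 (J1 :&: J2).
rewrite inE J1i0 J2i0 /=; move: ltJ1 ltJ2.
move: (\dim P1) (\dim P2) (\dim (P1 + P2)) (\dim (P1 :&: P2)).
move: (\dim (B :&: \bigcap_(i in J1 :|: J2) U i)) (\dim (B :&: _)).
move: #|J1| #|J2| #|J1 :|: J2| #|(J1 :&: J2) :\ i0| #|J1 :&: J2|.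
by clear; lia.
Qed.

(* Rado's theorem on linearly independent transversals, in dual form: the [b_i]
   are dual to functionals on [B] vanishing on [U i].  A [U i] of codimension at
   least 2 in [B] is the intersection of two larger subspaces, and by
   submodularity one of the two can replace it. *)
Lemma rado_dual (F : fieldType) (vT : vectType F) (B : {vspace vT}) (n : nat)
    (U : 'I_n -> {vspace vT}) :
    \dim B = n -> (forall i, (U i <= B)%VS) -> hall_cap B U ->
  exists2 b : n.-tuple vT, basis_of B b
    & forall i, (U i <= <<[seq tnth b j | j in predC1 i]>>)%VS.
Proof.
move=> dB; have [k] := ubnP (\sum_i (n - \dim (U i)))%N.
elim: k U => // k IHk U ltUk sUB hallU.
(* If every codimension is at most one, the condition at the full index set forces the total
   intersection to be 0. *)
have [/forallP leU|/forallPn[i0]] := boolP [forall i, (n <= (\dim (U i)).+1)%N].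
  apply: basis_of_hyperplanes => //; apply/eqP.
  rewrite -dimv_eq0 -leqn0 -(leq_add2r n) add0n.
  have /forallP/(_ [set: 'I_n]) := hallU; rewrite cardsT card_ord.
  by rewrite (eq_bigl predT) // => i; rewrite inE.
rewrite -ltnNge => ltUi0.
have [v Bv Uv] : exists2 v, v \in B & v \notin U i0.
  by apply: dimv_lt_notin; rewrite dB ltnW.
(* With [w] outside [U i0 + <[v]>], the extensions of [U i0] by [v] and by [w] meet exactly in
   [U i0]. *)
have [w Bw Xw] : exists2 w, w \in B & w \notin (U i0 + <[v]>)%VS.
  by apply: dimv_lt_notin; rewrite dB dimv_addv_line.
have Uw : w \notin U i0 by apply: contra Xw; apply: subvP (addvSl _ _) _.
have sXYU : ((U i0 + <[v]>) :&: (U i0 + <[w]>) <= U i0)%VS.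
  rewrite -(geq_leqif (dimv_leqif_sup _)); last by rewrite subv_cap !addvSl.
  have := dimv_sum_cap (U i0 + <[v]>) (U i0 + <[w]>).
  have ->: (U i0 + <[v]> + (U i0 + <[w]>) = U i0 + <[v]> + <[w]>)%VS.
    by rewrite addvA (addv_idPl (addvSl _ _)).
  rewrite !dimv_addv_line //; move: (\dim (U i0)) (\dim (_ :&: _)) => u c.
  by clear; lia.
have step z : z \in B -> z \notin U i0 ->
    hall_cap B (update_at i0 (U i0 + <[z]>)%VS U) ->
  exists2 b : n.-tuple vT, basis_of B b
    & forall i, (U i <= <<[seq tnth b j | j in predC1 i]>>)%VS.
  move=> Bz Uz hallz.
  have sUup i : (U i <= update_at i0 (U i0 + <[z]>)%VS U i)%VS.
    by rewrite /update_at; case: eqP => [->|]; rewrite ?addvSl.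
  have [||b basb sb] := IHk _ _ _ hallz.
  - move: ltUk; rewrite (bigD1 i0) //= [X in _ -> (X < _)%N](bigD1 i0) //=.
    rewrite [in X in _ -> X](eq_bigr (fun i => n - \dim (U i))%N); last first.
      by move=> i /negPf ne_i; rewrite /update_at ne_i.
    rewrite /update_at eqxx dimv_addv_line //.
    move: (\sum_(_ | _) _)%N (\dim (U i0)) ltUi0 => s u.
    by clear; lia.
  - move=> i; rewrite /update_at; case: eqP => // _.
    by rewrite subv_add sUB -memvE.
  - by exists b => // i; apply: subv_trans (sUup i) (sb i).
have /orP[] := hall_cap_enlarge hallU sXYU; exact: step.
Qed.

(** * Matchability through subspaces with product inside [A] *)

(** Let a basis of [A] start with one of [V]. For [i < \dim V], [W] lies in [a_i^-1 A :&: B], so in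
    a matched basis its [i]-th coordinates vanish; the [\dim A - \dim V] remaining ones are too few
    for [W]. *)
Lemma unmatchable_of_prodv_sub (K : fieldType) (L : fieldExtType K)
    (A B V W : {vspace L}) :
    (V <= A)%VS -> (W <= B)%VS -> (V * W <= A)%VS ->
    (\dim A < \dim V + \dim W)%N ->
  unmatchable A B.
Proof.
move=> sVA sWB sVWA ltA matchAB.
pose s := vbasis V ++ vbasis (A :\: V)%VS.
have sz_s : size s == \dim A.
  by rewrite size_cat !size_tuple -(dimv_cap_compl A V) (capv_idPr sVA).
have basA : basis_of A (Tuple sz_s).
  have defA: (V + (A :\: V))%VS = A by rewrite addvC addv_diff (addv_idPl sVA).
  rewrite -[X in basis_of X]defA; apply: cat_basis; rewrite ?vbasisP //.
  by apply/directv_addP; rewrite capvC capv_diff.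
have [b basb matchb] := matchAB _ basA.
have freeb := basis_free basb.
suffices /dimvS sW : (W <= <<drop (\dim V) b>>)%VS.
  have := leq_trans sW (dim_span _); rewrite size_drop size_tuple => leW.
  by move: ltA; rewrite ltnNge -leq_subRL ?dimvS // leW.
apply/subvP => w Ww; rewrite (coord_basis basb (subvP sWB _ Ww)).
apply: memv_suml => i _; have [ltiV|leVi] := ltnP i (\dim V); last first.
  rewrite memvZ // memv_span // -(subnKC leVi) -nth_drop mem_nth //.
  by rewrite size_drop size_tuple ltn_sub2r // (leq_ltn_trans leVi).
suffices ->: coord b i w = 0 by rewrite scale0r mem0v.
have Va : tnth (Tuple sz_s) i \in V.
  rewrite (tnth_nth 0) /= nth_cat size_tuple ltiV.
  by rewrite vbasis_mem // memt_nth.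
have nz_a : tnth (Tuple sz_s) i != 0 by rewrite (basis_not0 basA) ?mem_tnth.
have /(subvP (matchb i)): w \in ((<[(tnth (Tuple sz_s) i)^-1]> * A) :&: B)%VS.
  by rewrite memv_cap memv_prod_lineV // (subvP sVWA) ?memv_mul //= (subvP sWB).
suffices sbi: (<<[seq tnth b j | j in predC1 i]>>
               <= lker (linfun (coord b i : L -> K^o)))%VS.
  by move/(subvP sbi); rewrite memv_ker lfunE => /eqP.
apply/span_subvP => _ /imageP[j ne_ji ->].
by rewrite memv_ker lfunE /= (tnth_nth 0) coord_free // (negPf ne_ji).
Qed.

(** Rado's condition at [J] for the spaces [a_i^-1 A :&: B] is the hypothesis applied to the span
    [V] of the [a_i] with [i] in [J] and to the intersection [W], since [V * W <= A]. *)
Lemma matchable_of_dim_prodv (K : fieldType) (L : fieldExtType K) (A B : {vspace L}) :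
    \dim B = \dim A ->
    (forall V W : {vspace L}, (V <= A)%VS -> (W <= B)%VS -> (V * W <= A)%VS ->
      (\dim V + \dim W <= \dim A)%N) ->
  matchable A B.
Proof.
move=> dB leVW a basa.
pose U i := ((<[(tnth a i)^-1]> * A) :&: B)%VS.
have [|i||b basb sUb] := @rado_dual _ _ B (\dim A) U => //.
- exact: capvSr.
- apply/forallP => J; set W := (B :&: _)%VS.
  pose V := <<[seq tnth a i | i in J]>>%VS.
  have dV : \dim V = #|J|.
    have uniq_a : uniq a := free_uniq (basis_free basa).
    have perm_aJ : perm_eq [seq tnth a i | i in J]
                           [seq x <- a | x \in [seq tnth a i | i in J]].
      apply: uniq_perm; rewrite ?filter_uniq //.
        by rewrite map_inj_uniq ?enum_uniq //; apply/tuple_uniqP.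
      move=> x; rewrite mem_filter andb_idr // => /imageP[i _ ->].
      exact: mem_tnth.
    have /eqnP-> : free [seq tnth a i | i in J].
      by rewrite (perm_free perm_aJ) filter_free // (basis_free basa).
    by rewrite size_image.
  rewrite addnC -dV leVW //.
  + apply/span_subvP => _ /imageP[i _ ->]; exact: basis_mem basa (mem_tnth _ _).
  + exact: capvSl.
  apply/prodvP => v w Vv Ww.
  suffices sVAw : (V <= amulr w @^-1: A)%VS.
    by have := subvP sVAw _ Vv; rewrite -memv_preim lfunE.
  apply/span_subvP => _ /imageP[i Ji ->]; rewrite -memv_preim lfunE /=.
  have nz_a : tnth a i != 0 by rewrite (basis_not0 basa) ?mem_tnth.
  case/memv_capP: Ww => Bw; rewrite memvE => /subv_bigcapP/(_ i Ji).
  by rewrite -memvE memv_cap memv_prod_lineV // => /andP[].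
by exists b.
Qed.

(** * Unmatchable pairs over finite fields and divisors of the degree *)

Theorem corollary3p12 (K : finFieldType) (L : fieldExtType K) (m n : nat)
    (dimL : \dim {:L} = m) (m_gt1 : (1 < m)%N) (m_composite : ~~ prime m)
    (le_t_n : (pdiv m <= n)%N) (lt_n_m : (n < m)%N) :
  (exists A B : {vspace L},
     [/\ \dim A = n, \dim B = n, 1 \notin B & unmatchable A B])
  <->
  (exists d : nat, [/\ (0 < d)%N, (d %| m)%N, (d <= n)%N & ~~ (d %| n.+1)%N]).
Proof.
split=> [[A [B [dA dB B1]]] | [d [d_gt0 dvd_dm le_dn ndvd_d]]].
  (* Bounding [d] by [n] makes the existence of a divisor decidable, so matchability may be proved
     under its negation. *)
  have [/existsP[d /and3P[d_gt0 dvd_dm ndvd_d]] _|nex_d] :=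
    boolP [exists d : 'I_n.+1, [&& (0 < d)%N, (d %| m)%N & ~~ (d %| n.+1)%N]].
    by exists d; split=> //; rewrite -ltnS.
  case; apply: matchable_of_dim_prodv; rewrite ?dA ?dB // => V W sVA sWB sVWA.
  rewrite leqNgt; apply: contra nex_d => ltVW.
  have nzV : V != 0%VS.
    apply: contraTneq ltVW => ->; rewrite dimv0 add0n -leqNgt -dB; exact: dimvS.
  have W1 : 1 \notin W by apply: contra B1; apply: subvP.
  have [|F] := @subfield_not_dvdn _ _ _ V W nzV W1 sVA sVWA; rewrite dA //.
  case/andP=> leFn ndvdF; apply/existsP; exists (Ordinal (leFn : (\dim F < n.+1)%N)).
  by rewrite /= adim_gt0 ndvdF -dimL field_dimS ?subvf.
have [F dF] : exists F : {subfield L}, \dim F = d.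
  by apply: exists_subfield_dim; rewrite dimL.
have le_dk : (d * (n %/ d) <= n)%N by rewrite mulnC leq_trunc_div.
have [M modM dM] : exists2 M : {vspace L}, (F * M <= M)%VS & \dim M = (d * (n %/ d))%N.
  rewrite -dF; apply: exists_submodule_dim.
  by rewrite dF dimL (leq_trans le_dk) // ltnW.
have [v _ Mv] : exists2 v, v \in {:L}%VS & v \notin M.
  by apply: dimv_lt_notin; rewrite dM dimL (leq_ltn_trans le_dk).
have [A [sMA _ _ dA]] : exists X : {vspace L},
    [/\ (M <= X)%VS, (X <= {:L})%VS, v \notin X & \dim X = n].
  by apply: vspace_extend_avoiding; rewrite ?subvf ?memvf // dM le_dk dimL.
have [W [_ sWF W1 dW]] : exists X : {vspace L},
    [/\ (0 <= X)%VS, (X <= F)%VS, 1 \notin X & \dim X = d.-1].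
  apply: vspace_extend_avoiding; rewrite ?sub0v ?mem1v //.
    by rewrite memv0 oner_eq0.
  by rewrite dimv0 dF /= prednK.
have [B [sWB _ B1 dB]] : exists X : {vspace L},
    [/\ (W <= X)%VS, (X <= {:L})%VS, 1 \notin X & \dim X = n].
  apply: vspace_extend_avoiding; rewrite ?subvf ?memvf //.
  by rewrite dW dimL lt_n_m andbT (leq_trans (leq_pred d)).
exists A, B; split=> //.
apply: (@unmatchable_of_prodv_sub _ _ A B M W) => //.
  by rewrite prodvC (subv_trans _ sMA) // (subv_trans _ modM) // prodvSl.
(* With [r = n %% d], the dimensions of [M] and [W] add up to [n - r + d - 1], which exceeds [n]
   unless [r = d - 1], that is, unless [d] divides [n + 1]. *)
rewrite dA dM dW {1}(divn_eq n d) mulnC ltn_add2l.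
rewrite -ltnS prednK // ltn_neqAle ltn_mod d_gt0 andbT.
apply: contra ndvd_d => /eqP Dr.
by rewrite {1}(divn_eq n d) -addnS Dr dvdn_add ?dvdn_mull.
Qed.
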